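(* For $f(X):=\|X\|_{Fro}^2$ on the symmetric real $n\times n$ matrices, and integers $1\le k\le n$, it holds that $$\min_{\substack{X\in\mathcal{S}\\ \mathrm{Rk}(X)\le k}}f(X)=\frac1k.$$
   Context: $\mathcal{S}:=\{X\in\mathbb{S}^{n\times n} : X\succeq0,\ \mathrm{Tr}(X)=1\}$ is the spectahedron, where $\mathbb{S}^{n\times n}$ is the space of symmetric real $n\times n$ matrices. $\|\cdot\|_{Fro}$ is the Frobenius norm and $\mathrm{Rk}$ the rank. *)

(* Defs.v *)
From mathcomp Require Import all_boot all_order all_algebra.
From mathcomp Require Import sesquilinear classical_sets reals.

Set Implicit Arguments.
Unset Strict Implicit.
Unset Printing Implicit Defensive.

Import Order.TTheory GRing.Theory Num.Theory.

Local Open Scope classical_set_scope.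
Local Open Scope ring_scope.

(* Frobenius norm; the norm `|X| on matrices provided by MathComp-Analysis is
   the sup norm. *)
Definition frobenius_norm (R : realType) (m n : nat) (X : 'M[R]_(m, n)) : R :=
  Num.sqrt (\sum_i \sum_j X i j ^+ 2).

(* X >= 0 in the Loewner order. Symmetry is part of the definition, since a
   nonnegative quadratic form does not imply it over a real field. *)
Definition psdmx (R : realType) (n : nat) (X : 'M[R]_n) : Prop :=
  X \is symmetricmx /\ forall v : 'cV[R]_n, 0 <= (v^T *m X *m v) 0 0.

Definition spectahedron (R : realType) (n : nat) : set 'M[R]_n :=
  [set X | psdmx X /\ \tr X = 1].

Definition is_min (R : realType) (A : set R) (m : R) : Prop :=
  A m /\ lbound A m.

(* Main.v *)
Require Import Defs.
From mathcomp Require Import all_boot all_order all_algebra.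
From mathcomp Require Import sesquilinear classical_sets reals.
From mathcomp Require Import ring.

(** The lower bound is the inequality (tr X)^2 <= rank(X) * |X|_Fro^2, which
    holds for every square matrix X over a real field.  The usual argument
    applies Cauchy-Schwarz to the nonzero eigenvalues of X; replacing the
    eigenvalues by a projection avoids the spectral theorem altogether.  Let P
    be the orthogonal projection onto the row space of X.  Then X P = X, so
    tr X = tr (X P) is the Frobenius inner product of X with P, while
    |P|_Fro^2 = tr (P P) = tr P = rank X (projection_onto_rows).
    Cauchy-Schwarz for X and P is the claim (mxtrace_sqr_le).  On the
    spectahedron tr X = 1, hence 1 <= k * |X|_Fro^2 as soon as rank X <= k.

    Equality in Cauchy-Schwarz forces X to be proportional to a projection of
    rank k, so a minimiser is k^-1 times the projection onto the first k
    coordinates. *)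

Set Implicit Arguments.
Unset Strict Implicit.
Unset Printing Implicit Defensive.

Import Order.TTheory GRing.Theory Num.Theory.

Local Open Scope classical_set_scope.
Local Open Scope ring_scope.

Lemma mxtrace_mul_tr (F : pzRingType) (m n : nat) (A : 'M[F]_(m, n)) :
  \tr (A *m A^T) = \sum_i \sum_j A i j ^+ 2.
Proof.
by apply: eq_bigr => i _; rewrite !mxE; apply: eq_bigr => j _; rewrite mxE expr2.
Qed.

Lemma mxtrace_mul_tr_ge0 (F : realDomainType) (m n : nat) (A : 'M[F]_(m, n)) :
  0 <= \tr (A *m A^T).
Proof.
rewrite mxtrace_mul_tr; apply: sumr_ge0 => i _; apply: sumr_ge0 => j _.
exact: sqr_ge0.
Qed.

Lemma mxtrace_mul_tr_eq0 (F : realDomainType) (m n : nat) (A : 'M[F]_(m, n)) :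
  \tr (A *m A^T) = 0 -> A = 0.
Proof.
rewrite mxtrace_mul_tr => A0; apply/matrixP => i j; rewrite mxE.
have Ai0 : \sum_j A i j ^+ 2 = 0.
  by apply: (psumr_eq0P _ A0) => // l _; apply: sumr_ge0 => h _; apply: sqr_ge0.
have := psumr_eq0P (fun l (_ : true) => sqr_ge0 (A i l)) Ai0 (i := j) isT.
by move/eqP; rewrite sqrf_eq0 => /eqP.
Qed.

(** The orthogonal projection is given by the normal-equation formula
    P = B^T (B B^T)^-1 B, where the rows of B are a basis of the row space.  The
    Gram matrix B B^T is invertible because u B B^T = 0 makes |u B|^2 vanish. *)
Lemma projection_onto_rows (F : realFieldType) (m n : nat) (X : 'M[F]_(m, n)) :
  exists P : 'M[F]_n,
    [/\ P^T = P, P *m P = P, X *m P = X & \tr P = (\rank X)%:R].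
Proof.
move: (mulmx_base X) (row_base_free X).
move: (col_base X) (row_base X) => A B XE Bfree.
pose G := B *m B^T.
have Gu : G \in unitmx.
  rewrite -row_free_unit; apply: inj_row_free => u uG0.
  have uB0 : u *m B = 0.
    apply: mxtrace_mul_tr_eq0.
    by rewrite trmx_mul mulmxA -(mulmxA u B) uG0 mul0mx mxtrace0.
  by apply/eqP; rewrite -(mulmx_free_eq0 u Bfree) uB0.
have Gt : G^T = G by rewrite trmx_mul trmxK.
pose P := B^T *m (invmx G *m B).
have BP : B *m P = B by rewrite mulmxA mulmxA mulmxV // mul1mx.
exists P; split.
- by rewrite /P !trmx_mul trmxK trmx_inv Gt mulmxA.
- by rewrite {1}/P -!mulmxA BP.
- by rewrite -{1}XE -mulmxA BP.
- by rewrite mxtrace_mulC -mulmxA mulVmx // mxtrace1.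
Qed.

(** Cauchy-Schwarz against the projection P onto the row space of X, obtained
    from the nonnegativity of the Frobenius norm of (rank X) X - (tr X) P. *)
Lemma mxtrace_sqr_le (F : realFieldType) (n : nat) (X : 'M[F]_n) :
  (\tr X) ^+ 2 <= (\rank X)%:R * \tr (X *m X^T).
Proof.
have [r0|] := posnP (\rank X).
  move/eqP: r0; rewrite mxrank_eq0 => /eqP ->.
  by rewrite mul0mx mxtrace0 mulr0 expr0n.
have [P [Pt PP XP trP]] := projection_onto_rows X.
have PX : \tr (P *m X^T) = \tr X by rewrite -{1}Pt -trmx_mul mxtrace_tr XP.
rewrite -(ltr0n F) -trP => r_gt0.
have := mxtrace_mul_tr_ge0 (\tr P *: X - \tr X *: P).
have -> : (\tr P *: X - \tr X *: P)^T = \tr P *: X^T - \tr X *: P.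
  by rewrite linearB !linearZ /= Pt.
rewrite mulmxBl !mulmxBr -!scalemxAl -!scalemxAr XP PP.
rewrite !linearB /= !linearZ /= PX.
rewrite [Y in 0 <= Y](_ : _ = \tr P * (\tr P * \tr (X *m X^T) - \tr X ^+ 2)).
  by rewrite pmulr_rge0 // subr_ge0.
by ring.
Qed.

(** The matrix factors through the k-dimensional space, where the two factors
    compose in the other order to the identity. *)
Lemma mxtrace_pid_mx (F : comPzRingType) (n k : nat) :
  (k <= n)%N -> \tr (pid_mx k : 'M[F]_n) = k%:R.
Proof.
move=> le_kn.
by rewrite -(pid_mx_id F n n (leqnn k)) mxtrace_mulC pid_mx_id // pid_mx_1 mxtrace1.
Qed.

Lemma frobenius_norm_sqr (R : realType) (m n : nat) (X : 'M[R]_(m, n)) :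
  frobenius_norm X ^+ 2 = \tr (X *m X^T).
Proof. by rewrite /frobenius_norm -mxtrace_mul_tr sqr_sqrtr ?mxtrace_mul_tr_ge0. Qed.

Lemma psdmx_scale_projection (R : realType) (n : nat) (c : R) (P : 'M[R]_n) :
  0 <= c -> P^T = P -> P *m P = P -> psdmx (c *: P).
Proof.
move=> c_ge0 Pt PP; split.
  by apply/is_hermitianmxP; rewrite expr0 scale1r map_mx_id // linearZ /= Pt.
move=> v; rewrite -scalemxAr -scalemxAl mxE mulr_ge0 //.
(* v^T P v is the squared length of the projection of v *)
have -> : v^T *m P *m v = (v^T *m P) *m (v^T *m P)^T.
  by rewrite trmx_mul trmxK Pt mulmxA -(mulmxA _ P P) PP.
by rewrite -[X in 0 <= X]trace_mx11 mxtrace_mul_tr_ge0.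
Qed.

Theorem lemma21 (R : realType) (n k : nat) (hk : (1 <= k)%N) (hkn : (k <= n)%N) :
  is_min [set frobenius_norm X ^+ 2 | X in
            [set X : 'M[R]_n | spectahedron X /\ (\rank X <= k)%N]]
         (k%:R^-1).
Proof.
have k_gt0 : 0 < k%:R :> R by rewrite ltr0n.
split=> [|_ [X [[_ trX] rkX] <-]]; last first.
  rewrite frobenius_norm_sqr -[k%:R^-1]mul1r ler_pdivrMr // mulrC.
  have := mxtrace_sqr_le X; rewrite trX expr1n => /le_trans; apply.
  by rewrite ler_wpM2r ?mxtrace_mul_tr_ge0 ?ler_nat.
pose P : 'M[R]_n := pid_mx k.
have Pt : P^T = P by rewrite tr_pid_mx.
have PP : P *m P = P by rewrite pid_mx_id.
exists (k%:R^-1 *: P).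
  split; last by rewrite (leq_trans (mxrank_scale _ _)) ?rank_pid_mx.
  split; first by apply: psdmx_scale_projection => //; rewrite invr_ge0 ltW.
  by rewrite linearZ /= mxtrace_pid_mx // mulVf // gt_eqF.
rewrite frobenius_norm_sqr linearZ /= -scalemxAl -scalemxAr Pt PP !linearZ /=.
by rewrite mxtrace_pid_mx // mulVf ?mulr1 // gt_eqF.
Qed.
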